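(* Let $\mathcal{C}$ and $\mathcal{D}$ be categories, each equipped with a class of weak equivalences $\mathcal{W}$, and let $F:\mathcal{C}\rightleftarrows\mathcal{D}:G$ be a pair of adjoint functors ($F$ left adjoint to $G$) with adjunction morphisms $a:FG\to 1_{\mathcal{D}}$ and $b:1_{\mathcal{C}}\to GF$. Assume that the absolute left derived functor $(\mathbb{L}F,\ \epsilon:\mathbb{L}F\,\gamma_{\mathcal{C}}\to\gamma_{\mathcal{D}}F)$ of $F$ exists. If $\mathbb{L}F:\mathcal{C}[\mathcal{W}^{-1}]\to\mathcal{D}[\mathcal{W}^{-1}]$ admits a right adjoint $G':\mathcal{D}[\mathcal{W}^{-1}]\to\mathcal{C}[\mathcal{W}^{-1}]$, with adjunction morphisms $a':\mathbb{L}F\,G'\to 1$ and $b':1\to G'\,\mathbb{L}F$, then the absolute right derived functor $\mathbb{R}G$ of $G$ exists and it agrees with $G'$. In addition, the unit $\eta:\gamma_{\mathcal{C}}G\to G'\gamma_{\mathcal{D}}$ exhibiting $G'$ as the absolute right derived functor of $G$ may be chosen in such a way that $$(a'\gamma_{\mathcal{D}})\circ(\mathbb{L}F\,\eta)=(\gamma_{\mathcal{D}}a)\circ(\epsilon G):\ \mathbb{L}F\,\gamma_{\mathcal{C}}G\to\gamma_{\mathcal{D}}$$ and $$(G'\epsilon)\circ(b'\gamma_{\mathcal{C}})=(\eta F)\circ(\gamma_{\mathcal{C}}b):\ \gamma_{\mathcal{C}}\to G'\gamma_{\mathcal{D}}F .$$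
   Context: Composition of functors and whiskering of natural transformations by functors are written by juxtaposition; $\circ$ is vertical composition of natural transformations. A right Kan extension of $T:\mathcal{M}\to\mathcal{A}$ along $K:\mathcal{M}\to\mathcal{X}$ is a functor $Ran_KT:\mathcal{X}\to\mathcal{A}$ with a natural transformation (''unit'') $\epsilon:(Ran_KT)K\to T$ such that for every $L:\mathcal{X}\to\mathcal{A}$ the map $\mathrm{Nat}(L,Ran_KT)\to\mathrm{Nat}(LK,T)$, $\lambda\mapsto\epsilon\circ(\lambda K)$, is bijective. It is absolute if for every functor $S:\mathcal{A}\to\mathcal{B}$ the pair $(S\,Ran_KT,\ S\epsilon)$ is a right Kan extension of $ST$ along $K$. (Absolute) left Kan extensions $(Lan_KT,\ \eta:T\to(Lan_KT)K)$ are defined dually. A category $\mathcal{C}$ is equipped with an arbitrary class $\mathcal{W}$ of morphisms, called weak equivalences (the same letter is used for all categories). $\gamma_{\mathcal{C}}:\mathcal{C}\to\mathcal{C}[\mathcal{W}^{-1}]$ is the localization obtained by formally inverting $\mathcal{W}$ (a possibly large category): $\gamma_{\mathcal{C}}$ sends $\mathcal{W}$ to isomorphisms and precomposition with $\gamma_{\mathcal{C}}$ is an equivalence from functors $\mathcal{C}[\mathcal{W}^{-1}]\to\mathcal{E}$ to functors $\mathcal{C}\to\mathcal{E}$ sending $\mathcal{W}$ to isomorphisms, for every category $\mathcal{E}$. For $F:\mathcal{C}\to\mathcal{D}$, the absolute left derived functor of $F$ is the absolute right Kan extension $\mathbb{L}F=Ran_{\gamma_{\mathcal{C}}}(\gamma_{\mathcal{D}}F)$,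 with unit $\epsilon:\mathbb{L}F\,\gamma_{\mathcal{C}}\to\gamma_{\mathcal{D}}F$. For $G:\mathcal{D}\to\mathcal{C}$, the absolute right derived functor of $G$ is the absolute left Kan extension $\mathbb{R}G=Lan_{\gamma_{\mathcal{D}}}(\gamma_{\mathcal{C}}G)$, with unit $\eta:\gamma_{\mathcal{C}}G\to\mathbb{R}G\,\gamma_{\mathcal{D}}$. ''$\mathbb{R}G$ agrees with $G'$'' means that $G'$, with a suitable unit, is such an absolute left Kan extension. *)

(* Defs.v *)
From mathcomp Require Import ssreflect ssrfun ssrbool.
From mathcomp Require Import boolp.

Set Implicit Arguments.
Unset Strict Implicit.
Unset Printing Implicit Defensive.

Declare Scope cat_scope.
Delimit Scope cat_scope with cat.
Local Open Scope cat_scope.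

#[local] Obligation Tactic := idtac.

Reserved Notation "g \oc f" (at level 40, left associativity).
Reserved Notation "G \oF F" (at level 40, left associativity).
Reserved Notation "t \oN s" (at level 40, left associativity).

(* Objects and morphisms live in one and the same universe (forced by
   [functor_category] below), so that categories are closed under functor
   categories and under formal inversion of morphisms.  Smallness is never
   required. *)
Record category := Category {
  obj :> Type;
  hom : obj -> obj -> Type;
  idc : forall x, hom x x;
  comp : forall x y z, hom y z -> hom x y -> hom x z;
  comp_idl : forall x y (f : hom x y), comp (idc y) f = f;
  comp_idr : forall x y (f : hom x y), comp f (idc x) = f;
  compA : forall x y z w (h : hom z w) (g : hom y z) (f : hom x y),
    comp h (comp g f) = comp (comp h g) f }.

Arguments hom {c} x y.
Arguments idc {c} x.
Arguments comp {c x y z} g f.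
Arguments comp_idl {c x y} f.
Arguments comp_idr {c x y} f.
Arguments compA {c x y z w} h g f.

Notation "g \oc f" := (comp g f) : cat_scope.

Definition is_iso (C : category) (x y : C) (f : hom x y) : Prop :=
  exists g : hom y x, g \oc f = idc x /\ f \oc g = idc y.

Record functor (C D : category) := Functor {
  fobj :> C -> D;
  fmap : forall x y : C, hom x y -> hom (fobj x) (fobj y);
  fmap_id : forall x : C, fmap (idc x) = idc (fobj x);
  fmap_comp : forall (x y z : C) (g : hom y z) (f : hom x y),
    fmap (g \oc f) = fmap g \oc fmap f }.

Arguments fmap {C D} F {x y} f : rename.

Definition functor_id (C : category) : functor C C :=
  @Functor C C id (fun _ _ f => f) (fun _ => erefl) (fun _ _ _ _ _ => erefl).

Program Definition functor_comp (C D E : category)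
    (G : functor D E) (F : functor C D) : functor C E :=
  @Functor C E (fun x => G (F x)) (fun _ _ f => fmap G (fmap F f)) _ _.
Next Obligation. by move=> C D E G F x /=; rewrite !fmap_id. Qed.
Next Obligation. by move=> C D E G F x y z g f /=; rewrite !fmap_comp. Qed.

Notation "G \oF F" := (functor_comp G F) : cat_scope.

Record nattrans (C D : category) (F G : functor C D) := NatTrans {
  component :> forall x : C, hom (F x) (G x);
  naturality : forall (x y : C) (f : hom x y),
    component y \oc fmap F f = fmap G f \oc component x }.

Lemma nattrans_ext (C D : category) (F G : functor C D) (s t : nattrans F G) :
  (forall x, s x = t x) -> s = t.
Proof.
case: s t => [s sP] [t tP] /= st.
have {}st : s = t by exact: functional_extensionality_dep.
by case: _ / st tP => tP; rewrite (Prop_irrelevance sP tP).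
Qed.

Program Definition nat_id (C D : category) (F : functor C D) : nattrans F F :=
  @NatTrans C D F F (fun x => idc (F x)) _.
Next Obligation. by move=> C D F x y f /=; rewrite comp_idl comp_idr. Qed.

Program Definition nat_comp (C D : category) (F G H : functor C D)
    (t : nattrans G H) (s : nattrans F G) : nattrans F H :=
  @NatTrans C D F H (fun x => t x \oc s x) _.
Next Obligation.
by move=> C D F G H t s x y f /=; rewrite -compA naturality compA naturality compA.
Qed.

Notation "t \oN s" := (nat_comp t s) : cat_scope.

Program Definition whisker_left (C D E : category) (S : functor D E)
    (F G : functor C D) (t : nattrans F G) : nattrans (S \oF F) (S \oF G) :=
  @NatTrans C E (S \oF F) (S \oF G) (fun x => fmap S (t x)) _.
Next Obligation.
by move=> C D E S F G t x y f /=; rewrite -!fmap_comp naturality.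
Qed.

Program Definition whisker_right (C D E : category) (F G : functor D E)
    (t : nattrans F G) (K : functor C D) : nattrans (F \oF K) (G \oF K) :=
  @NatTrans C E (F \oF K) (G \oF K) (fun x => t (K x)) _.
Next Obligation. by move=> C D E F G t K x y f /=; rewrite naturality. Qed.

(* Composition of functors is associative only up to the proofs of the functor
   laws; these transformations with identity components mediate between the
   two bracketings. *)
Program Definition assoc_r (B C D E : category) (S : functor D E)
    (R : functor C D) (K : functor B C) :
    nattrans ((S \oF R) \oF K) (S \oF (R \oF K)) :=
  @NatTrans B E ((S \oF R) \oF K) (S \oF (R \oF K)) (fun x => idc (S (R (K x)))) _.
Next Obligation.
by move=> B C D E S R K x y f /=; rewrite comp_idl comp_idr.
Qed.

Program Definition assoc_l (B C D E : category) (S : functor D E)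
    (R : functor C D) (K : functor B C) :
    nattrans (S \oF (R \oF K)) ((S \oF R) \oF K) :=
  @NatTrans B E (S \oF (R \oF K)) ((S \oF R) \oF K) (fun x => idc (S (R (K x)))) _.
Next Obligation.
by move=> B C D E S R K x y f /=; rewrite comp_idl comp_idr.
Qed.

Definition is_adjunction (C D : category) (F : functor C D) (G : functor D C)
    (a : nattrans (F \oF G) (functor_id D))
    (b : nattrans (functor_id C) (G \oF F)) : Prop :=
  (forall x : C, a (F x) \oc fmap F (b x) = idc (F x)) /\
  (forall y : D, fmap G (a y) \oc b (G y) = idc (G y)).

Definition nat_isomorphic (C D : category) (F G : functor C D) : Prop :=
  exists t : nattrans F G, forall x : C, is_iso (t x).

Definition is_equivalence (C D : category) (F : functor C D) : Prop :=
  exists G : functor D C,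
    nat_isomorphic (functor_id C) (G \oF F) /\
    nat_isomorphic (F \oF G) (functor_id D).

Program Definition functor_category (C D : category) : category :=
  @Category (functor C D) (@nattrans C D) (@nat_id C D) (@nat_comp C D) _ _ _.
Next Obligation.
by move=> C D F G t; apply: nattrans_ext => x /=; rewrite comp_idl.
Qed.
Next Obligation.
by move=> C D F G t; apply: nattrans_ext => x /=; rewrite comp_idr.
Qed.
Next Obligation.
by move=> C D F G H K t s r; apply: nattrans_ext => x /=; rewrite compA.
Qed.

Definition full_subcategory (C : category) (P : C -> Prop) : category :=
  @Category {x : C | P x} (fun x y => hom (sval x) (sval y))
    (fun x => idc (sval x)) (fun _ _ _ g f => g \oc f)
    (fun _ _ f => comp_idl f) (fun _ _ f => comp_idr f)
    (fun _ _ _ _ h g f => compA h g f).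

Definition morphism_class (C : category) := forall x y : C, hom x y -> Prop.

Definition inverts (C D : category) (W : morphism_class C) (F : functor C D) :
    Prop :=
  forall (x y : C) (f : hom x y), W x y f -> is_iso (fmap F f).

Lemma inverts_comp (C D E : category) (W : morphism_class C) (F : functor C D) :
  inverts W F -> forall G : functor D E, inverts W (G \oF F).
Proof.
move=> FW G x y f /FW[g [gf fg]]; exists (fmap G g).
by rewrite /= -!fmap_comp gf fg !fmap_id.
Qed.

Definition inverting_functors (C : category) (W : morphism_class C)
    (E : category) : category :=
  @full_subcategory (functor_category C E) (fun F => inverts W F).

Program Definition precomposition (C D : category) (W : morphism_class C)
    (K : functor C D) (KW : inverts W K) (E : category) :
    functor (functor_category D E) (inverting_functors W E) :=
  @Functor (functor_category D E) (inverting_functors W E)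
    (fun G => exist _ (G \oF K) (inverts_comp KW G))
    (fun _ _ t => whisker_right t K) _ _.
Next Obligation. by move=> C D W K KW E G; apply: nattrans_ext. Qed.
Next Obligation. by move=> C D W K KW E F G H t s; apply: nattrans_ext. Qed.

Definition is_localization (C CW : category) (W : morphism_class C)
    (gamma : functor C CW) : Prop :=
  exists gammaW : inverts W gamma,
    forall E : category, is_equivalence (precomposition gammaW E).

Section KanExtensions.
Variables (M X A : category) (K : functor M X) (T : functor M A).

Definition is_right_kan (R : functor X A) (eps : nattrans (R \oF K) T) : Prop :=
  forall L : functor X A,
    bijective (fun lam : nattrans L R => eps \oN whisker_right lam K).

Definition is_left_kan (R : functor X A) (eta : nattrans T (R \oF K)) : Prop :=
  forall L : functor X A,
    bijective (fun lam : nattrans R L => whisker_right lam K \oN eta).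

End KanExtensions.

Definition is_absolute_right_kan (M X A : category) (K : functor M X)
    (T : functor M A) (R : functor X A) (eps : nattrans (R \oF K) T) : Prop :=
  is_right_kan eps /\
  forall (B : category) (S : functor A B),
    @is_right_kan M X B K (S \oF T) (S \oF R)
      (whisker_left S eps \oN assoc_r S R K).

Definition is_absolute_left_kan (M X A : category) (K : functor M X)
    (T : functor M A) (R : functor X A) (eta : nattrans T (R \oF K)) : Prop :=
  is_left_kan eta /\
  forall (B : category) (S : functor A B),
    @is_left_kan M X B K (S \oF T) (S \oF R)
      (assoc_l S R K \oN whisker_left S eta).

(* In the next two definitions [gC] and [gD] are the localization functors of
   the source and of the target of the functor being derived. *)
Definition is_absolute_left_derived (C D CW DW : category)
    (gC : functor C CW) (gD : functor D DW) (F : functor C D)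
    (LF : functor CW DW) (eps : nattrans (LF \oF gC) (gD \oF F)) : Prop :=
  is_absolute_right_kan eps.

Definition is_absolute_right_derived (C D CW DW : category)
    (gC : functor C CW) (gD : functor D DW) (F : functor C D)
    (RF : functor CW DW) (eta : nattrans (gD \oF F) (RF \oF gC)) : Prop :=
  is_absolute_left_kan eta.

(* Main.v *)
From mathcomp Require Import ssreflect ssrfun ssrbool.
Require Import Defs.

Set Implicit Arguments.
Unset Strict Implicit.
Unset Printing Implicit Defensive.

Local Open Scope cat_scope.

(** Fix functors [S : CW -> B] and [L : DW -> B].  Three bijections turn
    transformations out of [S G'] into transformations out of [S gC G]:
<<
      Nat(S G', L)  =  Nat(S, L LF)            transposition along LF -| G'
                    =  Nat(S gC, L gD F)       LF is an absolute Kan extension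
                    =  Nat(S gC G, L gD)       transposition along F -| G
>>
    The middle step is the universal property of [LF] after composition with
    the arbitrary functor [L], so it is absoluteness of [LF] that is used; as
    [S] is arbitrary too, absoluteness is also what comes out.

    The composite sends [lam] to [lam gD] precomposed with [S eta], where [eta]
    is the transpose of [(gD a) o (eps G) : LF gC G -> gD] along [LF -| G'].
    That is the universal property of an absolute left Kan extension.  The
    first compatibility equation says that transposing [eta] back through [a']
    recovers [(gD a) o (eps G)]; the second follows from the definition of
    [eta] by naturality and one triangle identity of [F -| G]. *)

Section Mates.
Variables (C D B : category) (F : functor C D) (G : functor D C).
Variables (a : nattrans (F \oF G) (functor_id D)).
Variables (b : nattrans (functor_id C) (G \oF F)).
Variables (S : functor C B) (L : functor D B).

Definition mate (lam : nattrans (S \oF G) L) : nattrans S (L \oF F) :=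
  whisker_right lam F \oN (assoc_l S G F \oN
    @NatTrans C B S (S \oF (G \oF F)) (fun x => fmap S (b x))
      (fun x y f => naturality (whisker_left S b) f)).

Definition mateV (mu : nattrans S (L \oF F)) : nattrans (S \oF G) L :=
  @NatTrans D B (L \oF (F \oF G)) L (fun y => fmap L (a y))
      (fun x y f => naturality (whisker_left L a) f)
    \oN (assoc_r L F G \oN whisker_right mu G).

Lemma mateE lam x : mate lam x = lam (F x) \oc fmap S (b x).
Proof. by rewrite /= comp_idl. Qed.

Lemma mateVE mu y : mateV mu y = fmap L (a y) \oc mu (G y).
Proof. by rewrite /= comp_idl. Qed.

Hypothesis adj : is_adjunction a b.

Lemma mateK : cancel mate mateV.
Proof.
move=> lam; apply: nattrans_ext => y; rewrite mateVE mateE compA.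
have /= <- := naturality lam (a y).
by rewrite -compA -fmap_comp adj.2 fmap_id comp_idr.
Qed.

Lemma mateVK : cancel mateV mate.
Proof.
move=> mu; apply: nattrans_ext => x; rewrite mateE mateVE -compA.
have /= -> := naturality mu (b x).
by rewrite compA -fmap_comp adj.1 fmap_id comp_idl.
Qed.

End Mates.

Section Reassociation.
Variables (M N X A : category).

Lemma assoc_l_bij (S : functor X A) (R : functor N X) (K : functor M N)
    (P : functor M A) :
  bijective (fun t : nattrans P (S \oF (R \oF K)) => assoc_l S R K \oN t).
Proof.
by exists (fun t => assoc_r S R K \oN t) => t; apply: nattrans_ext => x /=;
  rewrite !comp_idl.
Qed.

Lemma assoc_l_precomp_bij (S : functor X A) (R : functor N X) (K : functor M N)
    (Q : functor M A) :
  bijective (fun t : nattrans ((S \oF R) \oF K) Q => t \oN assoc_l S R K).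
Proof.
by exists (fun t => t \oN assoc_r S R K) => t; apply: nattrans_ext => x /=;
  rewrite !comp_idr.
Qed.

End Reassociation.

Section UnitFunctor.
Variables (M A : category) (P : functor M A).

Definition unit_l : nattrans P (functor_id A \oF P) :=
  @NatTrans M A P (functor_id A \oF P) (fun x => idc (P x))
    (fun x y f => naturality (nat_id P) f).

Definition unit_lV : nattrans (functor_id A \oF P) P :=
  @NatTrans M A (functor_id A \oF P) P (fun x => idc (P x))
    (fun x y f => naturality (nat_id P) f).

Lemma unit_lV_bij (Q : functor M A) :
  bijective (fun t : nattrans P Q => t \oN unit_lV).
Proof.
by exists (fun t => t \oN unit_l) => t; apply: nattrans_ext => x /=;
  rewrite !comp_idr.
Qed.

Lemma unit_l_bij (Q : functor M A) :
  bijective (fun t : nattrans (functor_id A \oF P) Q => t \oN unit_l).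
Proof.
by exists (fun t => t \oN unit_lV) => t; apply: nattrans_ext => x /=;
  rewrite !comp_idr.
Qed.

End UnitFunctor.

(** Composition with the identity functor is not strictly neutral, because the
    proofs of the functor laws change; hence the plain universal property has
    to be transported from the one stated after composition with [functor_id]. *)
Lemma is_absolute_left_kanP (M X A : category) (K : functor M X)
    (T : functor M A) (R : functor X A) (eta : nattrans T (R \oF K)) :
  (forall (B : category) (S : functor A B),
    is_left_kan (assoc_l S R K \oN whisker_left S eta)) ->
  is_absolute_left_kan eta.
Proof.
move=> kan; split=> // L.
have := bij_comp (unit_l_bij T (L \oF K))
  (bij_comp (kan _ (functor_id A) L) (unit_lV_bij R L)).
move/eq_bij; apply=> lam.
by apply: nattrans_ext => x /=; rewrite !comp_idr comp_idl.
Qed.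

Section DerivedAdjoint.
Variables (C D CW DW : category) (gC : functor C CW) (gD : functor D DW).
Variables (F : functor C D) (G : functor D C).
Variables (a : nattrans (F \oF G) (functor_id D)).
Variables (b : nattrans (functor_id C) (G \oF F)).
Hypothesis adjFG : is_adjunction a b.
Variables (LF : functor CW DW) (eps : nattrans (LF \oF gC) (gD \oF F)).
Variables (G' : functor DW CW).
Variables (a' : nattrans (LF \oF G') (functor_id DW)).
Variables (b' : nattrans (functor_id CW) (G' \oF LF)).
Hypothesis adjLFG' : is_adjunction a' b'.

(** The mate of [eps]: [eps] is transposed along [F -| G] on the source side
    and along [LF -| G'] on the target side. *)
Program Definition derived_unit : nattrans (gC \oF G) (G' \oF gD) :=
  @NatTrans _ _ (gC \oF G) (G' \oF gD)
    (fun d => fmap G' (fmap gD (a d) \oc eps (G d)) \oc b' (gC (G d))) _.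
Next Obligation.
have /= b'_nat := naturality b' (fmap gC (fmap G f)).
have /= eps_nat := naturality eps (fmap G f).
have /= a_nat := naturality a f.
rewrite -compA b'_nat !compA -!fmap_comp -compA eps_nat.
by rewrite !compA -!fmap_comp a_nat.
Qed.

Lemma derived_unit_counit d :
  a' (gD d) \oc fmap LF (derived_unit d) = fmap gD (a d) \oc eps (G d).
Proof.
rewrite /= fmap_comp compA.
have /= -> := naturality a' (fmap gD (a d) \oc eps (G d)).
by rewrite -compA adjLFG'.1 comp_idr.
Qed.

Lemma derived_unit_unit c :
  fmap G' (eps c) \oc b' (gC c) = derived_unit (F c) \oc fmap gC (b c).
Proof.
rewrite /= -compA; have /= -> := naturality b' (fmap gC (b c)).
rewrite compA -fmap_comp -compA; have /= -> := naturality eps (b c).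
by rewrite compA -fmap_comp adjFG.1 fmap_id comp_idl.
Qed.

(** Transposition along [LF -| G'], then [ranLF] at [L], then transposition
    along [F -| G] is a composite of bijections; naturality of the transformed
    [lam] identifies it with whiskering by [gD] followed by precomposition with
    [S derived_unit]. *)
Lemma derived_unit_left_kan (B : category) (S : functor CW B) :
  (forall L : functor DW B,
    is_right_kan (whisker_left L eps \oN assoc_r L LF gC)) ->
  is_left_kan (assoc_l S G' gD \oN whisker_left S derived_unit).
Proof.
move=> ranLF L.
have mate_bij : bijective (@mate _ _ _ LF G' b' S L).
  exact: Bijective (mateK adjLFG') (mateVK adjLFG').
have mateV_bij : bijective (@mateV _ _ _ F G a (S \oF gC) (L \oF gD)).
  exact: Bijective (mateVK adjFG) (mateK adjFG).
have := bij_comp (assoc_l_precomp_bij S gC G (L \oF gD))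
  (bij_comp mateV_bij (bij_comp (assoc_l_bij L gD F (S \oF gC))
  (bij_comp (ranLF L S) mate_bij))).
move/eq_bij; apply=> lam.
apply: nattrans_ext => d /=.
rewrite !(comp_idl, comp_idr) fmap_comp.
(* [lam] slides past [(gD a) o (eps G)], which turns [L] into [S G']. *)
have /= lam_nat := naturality lam (fmap gD (a d) \oc eps (G d)).
by rewrite !compA lam_nat fmap_comp.
Qed.

End DerivedAdjoint.

Theorem theorem3p4
  (C D : category) (WC : morphism_class C) (WD : morphism_class D)
  (CW DW : category) (gC : functor C CW) (gD : functor D DW)
  (gC_loc : is_localization WC gC) (gD_loc : is_localization WD gD)
  (F : functor C D) (G : functor D C)
  (a : nattrans (F \oF G) (functor_id D))
  (b : nattrans (functor_id C) (G \oF F))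
  (adjFG : is_adjunction a b)
  (LF : functor CW DW) (eps : nattrans (LF \oF gC) (gD \oF F))
  (LF_derived : is_absolute_left_derived eps)
  (G' : functor DW CW)
  (a' : nattrans (LF \oF G') (functor_id DW))
  (b' : nattrans (functor_id CW) (G' \oF LF))
  (adjLFG' : is_adjunction a' b') :
  exists eta : nattrans (gC \oF G) (G' \oF gD),
    [/\ is_absolute_right_derived eta,
        forall d : D,
          a' (gD d) \oc fmap LF (eta d) = fmap gD (a d) \oc eps (G d)
      & forall c : C,
          fmap G' (eps c) \oc b' (gC c) = eta (F c) \oc fmap gC (b c)].
Proof.
exists (derived_unit a eps b'); split; first 1 last.
- exact: derived_unit_counit.
- exact: derived_unit_unit.
apply: is_absolute_left_kanP => B S.
by apply: (derived_unit_left_kan adjFG adjLFG') => L; apply: LF_derived.2.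
Qed.
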